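(* Let $\mathcal F$ be a family of $N$-tuples $\alpha=(\alpha_i)_{i\le N}$ of real numbers (of arbitrary signs), and let $\sigma=\sup_{\alpha\in\mathcal F}\|\alpha\|_2$, where $\|\alpha\|_2=\big(\sum_{i\le N}\alpha_i^2\big)^{1/2}$. Let $(X_i)_{i\le N}$ be independent real random variables such that for each $i$ there is a number $r_i$ with $r_i\le X_i\le r_i+1$. Let $$Z=\sup_{\alpha\in\mathcal F}\sum_{i\le N}\alpha_iX_i$$ and let $M$ be a median of $Z$. Then, for all $u>0$, $$P(|Z-M|\ge u)\le4\exp\Big(-\frac{u^2}{4\sigma^2}\Big).$$
   Context: The family $\mathcal F$ is nonempty and $\sigma$ is understood to be finite; all functions are treated as measurable. *)

(* Defs.v *)
(* MathComp-Analysis, over an abstract [R : realType]. *)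
From HB Require Import structures.
From mathcomp Require Import all_boot all_order all_algebra.
From mathcomp Require Import all_classical all_reals all_analysis.
Set Implicit Arguments.
Unset Strict Implicit.
Unset Printing Implicit Defensive.
Import Order.TTheory GRing.Theory Num.Theory.
Import numFieldNormedType.Exports.
Local Open Scope classical_set_scope.
Local Open Scope ring_scope.

(* The library's norm on ['rV[R]_N] is the sup norm, not this one. *)
Definition l2norm (R : realType) (N : nat) (a : 'rV[R]_N) : R :=
  Num.sqrt (\sum_(i < N) a 0 i ^+ 2).

Definition mutually_independent (R : realType) (d : measure_display)
    (T : measurableType d) (P : probability T R) (I : finType)
    (X : I -> {RV P >-> R}) : Prop :=
  forall (J : {set I}) (B : I -> set R),
    (forall i, i \in J -> measurable (B i)) ->
    P (\bigcap_(i in [set` J]) X i @^-1` B i) =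
    (\prod_(i in J) P (X i @^-1` B i))%E.

Definition is_median (R : realType) (d : measure_display)
    (T : measurableType d) (P : probability T R) (Z : T -> R) (M : R) : Prop :=
  ((2^-1)%:E <= P [set w | (Z w <= M)%R])%E /\
  ((2^-1)%:E <= P [set w | (M <= Z w)%R])%E.

(* Main.v *)
(* Maurey's infimum-convolution argument.  For independent coordinates, each in
   a set of diameter at most 1, every convex f satisfies
   E exp(Qf) * E exp(-f) <= 1, where Qf(x) = inf_y f(y) + |x - y|^2 / 4.  The
   one-dimensional case is an explicit inequality obtained by moving from a
   point towards the minimiser of f, and the property tensorises because a
   log-average of convex functions is convex.  Since Z is a sigma-Lipschitz
   convex function of (X_i), taking f = lam Z gives
   E exp(lam Z) * E exp(-lam Z) <= exp(lam^2 sigma^2), hence, with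
   lam = u / (2 sigma^2), P(Z >= c + u) P(Z <= c) <= exp(-u^2 / (4 sigma^2));
   one uses this for c = M and for c = M - u.  To avoid integrals, each X_i is
   first rounded to the grid of mesh 1/m, which makes all averages finite sums,
   and m tends to infinity at the end. *)
Require Import Defs.
From HB Require Import structures.
From mathcomp Require Import all_boot all_order all_algebra.
From mathcomp Require Import all_classical all_reals all_analysis.
From mathcomp Require Import ring lra.
Set Implicit Arguments.
Unset Strict Implicit.
Unset Printing Implicit Defensive.
Import Order.TTheory GRing.Theory Num.Theory.
Import numFieldNormedType.Exports.
Local Open Scope classical_set_scope.
Local Open Scope ring_scope.

(** * The one-dimensional exponential inequality *)

Lemma expR_convex_comb (R : realType) (th a b : R) : 0 <= th <= 1 ->
  expR (th * a + (1 - th) * b) <= th * expR a + (1 - th) * expR b.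
Proof.
move=> /andP[th0 th1].
set c := th * a + (1 - th) * b.
have tangent (z : R) : expR c * (1 + (z - c)) <= expR z.
  have -> : expR z = expR c * expR (z - c) by rewrite -expRD addrC subrK.
  by rewrite ler_pM2l ?expR_gt0// expR_ge1Dx.
have Ha := ler_wpM2l th0 (tangent a).
have th1' : 0 <= 1 - th by rewrite subr_ge0.
have Hb := ler_wpM2l th1' (tangent b).
apply: le_trans (lerD Ha Hb).
by rewrite le_eqVlt; apply/orP; left; apply/eqP; rewrite /c; ring.
Qed.

(** After multiplication by [E = expR (- s)] the right side is 1 - (1 - E)^2, and
    [E >= (1 - s / 2) ^+ 2] gives 1 - E <= s - s^2/4. The left side becomes exp(-s^2) <= 1/(1 +
    s^2), so a polynomial inequality remains. *)
Lemma expR_quadratic_le (R : realType) (s : R) : 0 <= s <= 2^-1 ->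
  expR (s - s ^+ 2) <= 2 - expR (- s).
Proof.
move=> /andP[s0 s12].
set E := expR (- s).
have E_gt0 : 0 < E by exact: expR_gt0.
have E_le1 : E <= 1 by rewrite /E expR_le1 oppr_le0.
have E_ge : (1 - s / 2) ^+ 2 <= E.
  have -> : E = expR (- (s / 2)) ^+ 2 by rewrite /E expr2 -expRD; congr expR; lra.
  by rewrite lerXn2r ?nnegrE ?expR_ge0 ?expR_ge1Dx//; lra.
have gauss : expR (- s ^+ 2) <= (1 + s ^+ 2)^-1.
  rewrite expRN lef_pV2 ?posrE ?expR_gt0 ?expR_ge1Dx//.
  by rewrite ltr_pwDl ?sqr_ge0.
rewrite -(ler_pM2r E_gt0).
have -> : expR (s - s ^+ 2) * E = expR (- s ^+ 2).
  by rewrite /E -expRD; congr expR; ring.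
apply: (le_trans gauss).
have sq0 : 0 < 1 + s ^+ 2 by rewrite ltr_pwDl ?sqr_ge0.
rewrite -[leLHS]mul1r ler_pdivrMr//.
have -> : (2 - E) * E = 1 - (1 - E) ^+ 2 by ring.
have D_le : (1 - E) ^+ 2 <= (s - s ^+ 2 / 4) ^+ 2.
  rewrite lerXn2r ?nnegrE; [|lra|nra|].
  - by [].
  - by move: E_ge; nra.
apply: (@le_trans _ _ ((1 - (s - s ^+ 2 / 4) ^+ 2) * (1 + s ^+ 2))); last first.
  by apply: ler_wpM2r; [exact: ltW|rewrite lerD2l lerN2].
(* The difference of the two sides is s^3 times this cubic. *)
have poly_ge0 : 0 <= 2^-1 - 17 / 16 * s + s ^+ 2 / 2 - s ^+ 3 / 16.
  have s3 : s ^+ 3 <= s ^+ 2 by rewrite exprS ler_piMl ?sqr_ge0//; lra.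
  nra.
have := mulr_ge0 (exprn_ge0 3 s0) poly_ge0.
lra.
Qed.

(** Here [s] is the height of a point above the minimum and [th] the fraction of the way moved
    towards the minimiser. The exponent is least at [th = 2 * s], admissible up to s = 1/2; beyond
    that the move goes all the way. *)
Lemma expR_interpolation (R : realType) (s : R) : 0 <= s ->
  exists2 th : R, 0 <= th <= 1 &
    expR ((1 - th) * s + th ^+ 2 / 4) <= 2 - expR (- s).
Proof.
move=> s0; case: (leP s 2^-1) => s12.
  exists (2 * s); first by apply/andP; split; lra.
  have -> : (1 - 2 * s) * s + (2 * s) ^+ 2 / 4 = s - s ^+ 2 by field.
  by apply: expR_quadratic_le; rewrite s0.
exists 1; first by rewrite ler01 lexx.
have -> : (1 - 1) * s + 1 ^+ 2 / 4 = 4^-1 :> R by field.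
set b := expR (- 4^-1 : R).
have b_ge : 3 / 4 <= b.
  by apply: le_trans (expR_ge1Dx _); lra.
have b_le1 : b <= 1 by rewrite /b expR_le1; lra.
have eb : expR 4^-1 * b = 1 :> R by rewrite /b -expRD subrr expR0.
have Es : expR (- s) <= b ^+ 2.
  by rewrite /b expr2 -expRD ler_expR; lra.
have b0 : 0 < b by lra.
apply: (@le_trans _ _ (2 - b ^+ 2)); last by rewrite lerD2l lerN2.
rewrite -(ler_pM2r b0) eb.
(* The product equals 2b - b^3 - 1, which is the difference of the two sides. *)
have : 0 <= (1 - b) * (b ^+ 2 + b - 1) by apply: mulr_ge0; [lra|nra].
lra.
Qed.

(** [q] stands for a minorant of the infimum convolution of [phi] at the atoms. Relative to the
    minimum [m] of [phi] over the atoms, the interpolation bounds the mean of exp(q - m) by 2 - B,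
    where B is the mean of exp(m - phi), and (2 - B) B <= 1. *)
Lemma maurey_dim1 (R : realType) (J : finType) (p t q : J -> R) (phi : R -> R) :
  (forall j, 0 <= p j) -> \sum_j p j = 1 -> (forall j k, `|t j - t k| <= 1) ->
  (forall th a b, 0 <= th <= 1 ->
     phi (th * a + (1 - th) * b) <= th * phi a + (1 - th) * phi b) ->
  (forall j v, q j <= phi v + (t j - v) ^+ 2 / 4) ->
  (\sum_j p j * expR (q j)) * (\sum_j p j * expR (- phi (t j))) <= 1.
Proof.
move=> p0 p1 t_diam phi_convex q_le.
case: (pickP (fun _ : J => true)) => [j0 _|J0]; last first.
  by move: p1; rewrite big_pred0// => /esym/eqP; rewrite oner_eq0.
have [k _ k_min] := @arg_minP _ R J j0 xpredT (fun j => phi (t j)) isT.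
set m := phi (t k).
have q_bound j : expR (q j - m) <= 2 - expR (- (phi (t j) - m)).
  have s0 : 0 <= phi (t j) - m by rewrite subr_ge0; exact: k_min.
  have [th th01 le_th] := expR_interpolation s0.
  apply: le_trans le_th; rewrite ler_expR.
  have th'01 : 0 <= 1 - th <= 1 by lra.
  (* The competitor lies at fraction [th] of the way from [t j] to the minimising atom [t k]; since
     the diameter is at most 1, its quadratic cost is at most th^2/4. *)
  have := q_le j ((1 - th) * t j + (1 - (1 - th)) * t k).
  have := phi_convex _ (t j) (t k) th'01; rewrite -/m.
  have -> : t j - ((1 - th) * t j + (1 - (1 - th)) * t k) = th * (t j - t k) by ring.
  have D2 : (t j - t k) ^+ 2 <= 1 by rewrite -real_normK ?num_real// exprn_ile1.
  have : (th * (t j - t k)) ^+ 2 <= th ^+ 2.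
    by rewrite exprMn ler_piMr// sqr_ge0.
  lra.
set A := \sum_j p j * expR (q j - m).
set B := \sum_j p j * expR (- (phi (t j) - m)).
have -> : (\sum_j p j * expR (q j)) * (\sum_j p j * expR (- phi (t j))) = A * B.
  have -> : \sum_j p j * expR (q j) = expR m * A.
    rewrite mulr_sumr; apply: eq_bigr => j _.
    by rewrite mulrCA -expRD; congr (_ * expR _); ring.
  have -> : \sum_j p j * expR (- phi (t j)) = expR (- m) * B.
    rewrite mulr_sumr; apply: eq_bigr => j _.
    by rewrite mulrCA -expRD; congr (_ * expR _); ring.
  by rewrite mulrACA -expRD subrr expR0 mul1r.
have B0 : 0 <= B by apply: sumr_ge0 => j _; rewrite mulr_ge0 ?expR_ge0.
have AB : A <= 2 - B.
  have -> : 2 - B = \sum_j p j * (2 - expR (- (phi (t j) - m))).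
    have two : \sum_j p j * 2 = 2 by rewrite -mulr_suml p1 mul1r.
    rewrite -[X in X - B]two /B -sumrB; by apply: eq_bigr => j _; rewrite mulrBr.
  by apply: ler_sum => j _; rewrite ler_wpM2l.
apply: (le_trans (ler_wpM2r B0 AB)).
have : 0 <= (1 - B) ^+ 2 by exact: sqr_ge0.
lra.
Qed.

(** * Finite weighted sums and log-averages *)

Lemma sum_weights_gt0 (R : realType) (J : finType) (p e : J -> R) :
  (forall j, 0 <= p j) -> \sum_j p j = 1 -> (forall j, 0 < e j) ->
  0 < \sum_j p j * e j.
Proof.
move=> p0 p1 e0.
rewrite lt_neqAle eq_sym sumr_ge0 ?andbT; last by move=> j _; rewrite mulr_ge0 ?(ltW (e0 j)).
apply/eqP => /eqP; rewrite psumr_eq0; last by move=> j _; rewrite mulr_ge0 ?(ltW (e0 j)).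
move=> /allP all0.
have /eqP : 1 = 0 :> R.
  rewrite -p1 big1// => j _; have := all0 j (mem_index_enum j).
  by rewrite /= mulf_eq0 (gt_eqF (e0 j)) orbF => /eqP.
by rewrite oner_eq0.
Qed.

(** Subtracting the logarithms [A] and [B] from the exponents normalises both sums to 1; convexity
    of exp inside the sum then gives at most th + (1 - th) = 1. *)
Lemma ln_sum_expR_convex (R : realType) (J : finType) (p a b : J -> R) (th : R) :
  (forall j, 0 <= p j) -> \sum_j p j = 1 -> 0 <= th <= 1 ->
  ln (\sum_j p j * expR (th * a j + (1 - th) * b j)) <=
  th * ln (\sum_j p j * expR (a j)) + (1 - th) * ln (\sum_j p j * expR (b j)).
Proof.
move=> p0 p1 th01.
have S_gt0 c : 0 < \sum_j p j * expR (c j).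
  by apply: sum_weights_gt0 => // j; exact: expR_gt0.
have linear_in (u v : J -> R) : \sum_j p j * (th * u j + (1 - th) * v j) =
    th * (\sum_j p j * u j) + (1 - th) * (\sum_j p j * v j).
  by rewrite !mulr_sumr -big_split; apply: eq_bigr => j _ /=; ring.
have [A defA] : exists A, A = ln (\sum_j p j * expR (a j)) by eexists.
have [B defB] : exists B, B = ln (\sum_j p j * expR (b j)) by eexists.
rewrite -defA -defB.
have normalised c L : L = ln (\sum_j p j * expR (c j)) -> \sum_j p j * expR (c j - L) = 1.
  move=> ->; under eq_bigr do rewrite expRD mulrA.
  by rewrite -mulr_suml expRN lnK ?posrE// divff// gt_eqF.
rewrite -ler_expR lnK ?posrE//.
rewrite -[leRHS]mul1r -ler_pdivrMr ?expR_gt0// -expRN mulr_suml.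
apply: (@le_trans _ _ (\sum_j p j * (th * expR (a j - A) + (1 - th) * expR (b j - B)))).
  apply: ler_sum => j _; rewrite -mulrA -expRD ler_wpM2l//.
  apply: le_trans (expR_convex_comb _ _ th01).
  by rewrite ler_expR le_eqVlt; apply/orP; left; apply/eqP; ring.
have -> : \sum_j p j * (th * expR (a j - A) + (1 - th) * expR (b j - B)) =
    th * (\sum_j p j * expR (a j - A)) + (1 - th) * (\sum_j p j * expR (b j - B)).
  by rewrite linear_in.
by rewrite (normalised a A defA) (normalised b B defB) !mulr1 addrC subrK.
Qed.

(** * Averaging and infimum convolution, one coordinate at a time *)

Definition upd (I : eqType) (V : Type) (x : I -> V) (i : I) (v : V) : I -> V :=
  fun k => if k == i then v else x k.

(** Expectation in coordinate [i] alone, under the law with atoms [t i j] and weights [p i j]; the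
    result no longer depends on [x i]. *)
Definition average (R : realType) (I : eqType) (J : finType) (p t : I -> J -> R)
    (i : I) (h : (I -> R) -> R) : (I -> R) -> R :=
  fun x => \sum_j p i j * h (upd x i (t i j)).

(** With [foldl] the head of [s] is averaged first, that is, innermost. *)
Definition iter_average (R : realType) (I : eqType) (J : finType)
    (p t : I -> J -> R) (s : seq I) (h : (I -> R) -> R) : (I -> R) -> R :=
  foldl (fun h i => average p t i h) h s.

Definition convex_fun (R : realType) (I : Type) (f : (I -> R) -> R) : Prop :=
  forall (th : R) (x y : I -> R), 0 <= th <= 1 ->
    f (fun k => th * x k + (1 - th) * y k) <= th * f x + (1 - th) * f y.

(** Only coordinate [i] is moved; [c] is its starting value and [x i] itself is not read. *)
Definition inf_conv (R : realType) (I : eqType) (f : (I -> R) -> R) (i : I)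
    (c : R) (x : I -> R) : R :=
  inf [set f (upd x i v) + (c - v) ^+ 2 / 4 | v in [set: R]].

Definition log_average (R : realType) (I : eqType) (J : finType)
    (p t : I -> J -> R) (i : I) (f : (I -> R) -> R) : (I -> R) -> R :=
  fun x => ln (\sum_j p i j * expR (inf_conv f i (t i j) x)).

Lemma iter_average_le (R : realType) (I : eqType) (J : finType)
    (p t : I -> J -> R) (s : seq I) (h1 h2 : (I -> R) -> R) (x : I -> R) :
  (forall i j, 0 <= p i j) -> (forall y, h1 y <= h2 y) ->
  iter_average p t s h1 x <= iter_average p t s h2 x.
Proof.
move=> p0; elim: s h1 h2 => [|i s IHs] h1 h2 le_h /=; first exact: le_h.
by apply: IHs => y; apply: ler_sum => j _; rewrite ler_wpM2l.
Qed.

Lemma iter_average_ge0 (R : realType) (I : eqType) (J : finType)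
    (p t : I -> J -> R) (s : seq I) (h : (I -> R) -> R) (x : I -> R) :
  (forall i j, 0 <= p i j) -> (forall y, 0 <= h y) ->
  0 <= iter_average p t s h x.
Proof.
move=> p0; elim: s h => [|i s IHs] h h0 /=; first exact: h0.
by apply: IHs => y; apply: sumr_ge0 => j _; rewrite mulr_ge0.
Qed.

Lemma iter_averageZ (R : realType) (I : eqType) (J : finType)
    (p t : I -> J -> R) (s : seq I) (c : R) (h : (I -> R) -> R) (x : I -> R) :
  iter_average p t s (fun y => c * h y) x = c * iter_average p t s h x.
Proof.
elim: s h => [//|i s IHs] h /=; rewrite -/(iter_average _ _ _ _ _) -IHs.
congr (iter_average _ _ _ _ _); apply/funext => y.
by rewrite /average mulr_sumr; apply: eq_bigr => j _; rewrite mulrCA.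
Qed.

(** Partial minimisation of a jointly convex function: a convex combination of near-minimisers for
    [x] and [y] is a competitor at the combined point. *)
Lemma inf_conv_convex (R : realType) (I : eqType) (f : (I -> R) -> R) (i : I) (c : R) :
  convex_fun f ->
  (forall x, has_lbound [set f (upd x i v) + (c - v) ^+ 2 / 4 | v in [set: R]]) ->
  convex_fun (inf_conv f i c).
Proof.
move=> f_convex f_lb th x y th01.
have /andP[th0 th1] := th01.
apply/ler_addgt0Pr => e e0.
have approx z : exists v, f (upd z i v) + (c - v) ^+ 2 / 4 <= inf_conv f i c z + e.
  have [|_ [v _ <-] /ltW ?] := @inf_adherent R _ e e0 (conj _ (f_lb z)); last by exists v.
  by exists (f (upd z i 0) + (c - 0) ^+ 2 / 4); exists 0.
have [v Hv] := approx x; have [w Hw] := approx y.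
apply: (@le_trans _ _
  (f (upd (fun k => th * x k + (1 - th) * y k) i (th * v + (1 - th) * w)) +
   (c - (th * v + (1 - th) * w)) ^+ 2 / 4)).
  by apply: ge_inf => //; exists (th * v + (1 - th) * w).
have -> : upd (fun k => th * x k + (1 - th) * y k) i (th * v + (1 - th) * w) =
    (fun k => th * upd x i v k + (1 - th) * upd y i w k).
  by apply/funext => k; rewrite /upd; case: eqP.
have := f_convex th (upd x i v) (upd y i w) th01.
have th1' : 0 <= 1 - th by rewrite subr_ge0.
have := ler_wpM2l th0 Hv; have := ler_wpM2l th1' Hw.
(* This is the convexity defect of the square. *)
have : 0 <= th * (1 - th) * (v - w) ^+ 2.
  exact: mulr_ge0 (mulr_ge0 th0 th1') (sqr_ge0 _).
lra.
Qed.

(* Maurey's property (tau) for convex functions, with any [g <= Qf] in place of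
   [Qf].  The coordinate averaged first replaces [f] by [log_average p t i f],
   which is still convex, so the induction applies to the other coordinates. *)
Lemma maurey (R : realType) (I : eqType) (J : finType) (p t : I -> J -> R)
    (s : seq I) (f g : (I -> R) -> R) (x0 : I -> R) :
  (forall i j, 0 <= p i j) -> (forall i, \sum_j p i j = 1) ->
  (forall i j k, `|t i j - t i k| <= 1) ->
  uniq s -> convex_fun f ->
  (forall x y, g x <= f y + \sum_(k <- s) (x k - y k) ^+ 2 / 4) ->
  iter_average p t s (fun x => expR (g x)) x0 *
  iter_average p t s (fun x => expR (- f x)) x0 <= 1.
Proof.
move=> p0 p1 t_diam; elim: s f g => [|i s IHs] f g.
  move=> _ _ /(_ x0 x0); rewrite big_nil addr0 /= => gf.
  by rewrite -expRD expR_le1 subr_le0.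
move=> /= /andP[i_s s_uniq] f_convex gf.
have sum_upd x y v w : \sum_(k <- s) (upd x i v k - upd y i w k) ^+ 2 / 4 =
    \sum_(k <- s) (x k - y k) ^+ 2 / 4.
  apply: eq_big_seq => k k_s; rewrite /upd.
  by case: eqP => // ki; move: i_s; rewrite -ki k_s.
have gf_upd x y j v : g (upd x i (t i j)) <=
    f (upd y i v) + (t i j - v) ^+ 2 / 4 + \sum_(k <- s) (x k - y k) ^+ 2 / 4.
  have := gf (upd x i (t i j)) (upd y i v).
  by rewrite big_cons sum_upd /upd eqxx addrA.
(* The values of [g] bound the set from below, so each [inf] is a true infimum. *)
have f_lb j y : has_lbound [set f (upd y i v) + (t i j - v) ^+ 2 / 4 | v in [set: R]].
  exists (g (upd y i (t i j))) => _ [v _ <-].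
  have := gf_upd y y j v; rewrite [X in _ + X]big1 ?addr0// => k _.
  by rewrite subrr expr0n mul0r.
have S_gt0 c : 0 < \sum_j p i j * expR (c j).
  by apply: sum_weights_gt0 => // j; exact: expR_gt0.
set f1 := log_average p t i f.
set g1 := fun x => ln (\sum_j p i j * expR (g (upd x i (t i j)))).
have f1_convex : convex_fun f1.
  move=> th x y th01.
  apply: le_trans (ln_sum_expR_convex _ _ (p0 i) (p1 i) th01).
  rewrite ler_ln ?posrE ?S_gt0//; apply: ler_sum => j _.
  rewrite ler_wpM2l// ler_expR.
  by apply: inf_conv_convex => //; exact: f_lb.
have gf1 x y : g1 x <= f1 y + \sum_(k <- s) (x k - y k) ^+ 2 / 4.
  rewrite -ler_expR expRD !lnK ?posrE// mulr_suml.
  apply: ler_sum => j _; rewrite -mulrA -expRD ler_wpM2l// ler_expR.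
  rewrite -lerBlDr; apply: lb_le_inf.
    by exists (f (upd y i 0) + (t i j - 0) ^+ 2 / 4); exists 0.
  by move=> _ [v _ <-]; rewrite lerBlDr.
have := IHs f1 g1 s_uniq f1_convex gf1.
apply: le_trans.
have -> : average p t i (fun x => expR (g x)) = (fun x => expR (g1 x)).
  by apply/funext => x; rewrite /g1 lnK ?posrE.
apply: ler_wpM2l; first by apply: iter_average_ge0 => // y; exact: expR_ge0.
apply: iter_average_le => // x.
(* The one-dimensional inequality along coordinate [i], rearranged: the average of exp(-f) is at
   most exp(-f1). *)
rewrite expRN -[leRHS]mul1r ler_pdivlMr ?expR_gt0// mulrC lnK ?posrE//.
apply: (@maurey_dim1 _ _ _ _ _ (fun v => f (upd x i v))) => //.
- move=> th a b th01; apply: le_trans (f_convex _ _ _ th01).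
  rewrite le_eqVlt; apply/orP; left; apply/eqP; congr f; apply/funext => k.
  by rewrite /upd; case: eqP => // _; ring.
- by move=> j v; apply: ge_inf => //; exists v.
Qed.

(** * From probabilities to finite averages *)

Lemma content_bigsetU_le (d : measure_display) (T : measurableType d)
    (R : realType) (mu : {measure set T -> \bar R}) (J : Type) (r : seq J)
    (F : J -> set T) :
  (forall j, measurable (F j)) ->
  (mu (\big[setU/set0]_(j <- r) F j) <= \sum_(j <- r) mu (F j))%E.
Proof.
move=> mF; elim: r => [|j r IHr]; first by rewrite !big_nil measure0.
rewrite !big_cons; apply: le_trans (leeD2l _ IHr).
by apply: measureU2 => //; apply: bigsetU_measurable.
Qed.

Lemma finType_bigcap_measurable (d : measure_display) (T : measurableType d)
    (I : finType) (D : set I) (A : I -> set T) :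
  (forall i, measurable (A i)) -> measurable (\bigcap_(i in D) A i).
Proof. by move=> mA; apply: fin_bigcap_measurable. Qed.

(** An exponential Markov bound without integrals: the cells cover the space up to null sets, and
    [H] is at least 1 at the grid point of every product cell that meets [C]. *)
Lemma probability_le_iter_average (R : realType) (I J : finType)
    (d : measure_display) (T : measurableType d) (P : probability T R)
    (p t : I -> J -> R) (E : I -> J -> set T) (C : set T)
    (H : (I -> R) -> R) (y0 : I -> J) :
  (forall i j, measurable (E i j)) -> measurable C ->
  (forall i, P (~` \bigcup_j E i j) = 0%E) ->
  (forall i j, 0 <= p i j) ->
  (forall y : I -> J, P (\bigcap_i E i (y i)) = (\prod_i p i (y i))%:E) ->
  (forall x, 0 <= H x) ->
  (forall w y, C w -> (forall i, E i (y i) w) -> 1 <= H (fun i => t i (y i))) ->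
  (P C <= (iter_average p t (enum I) H (fun i => t i (y0 i)))%:E)%E.
Proof.
move=> mE mC E_cover p0 E_indep H0 H1.
have m_cell (s : seq I) y : measurable (C `&` \bigcap_(i in [set i | i \notin s]) E i (y i)).
  by apply: measurableI => //; exact: finType_bigcap_measurable.
(* [s] lists the coordinates already averaged; the others are fixed by [y]. *)
have cell (s : seq I) (y : I -> J) : uniq s ->
    (P (C `&` \bigcap_(i in [set i | i \notin s]) E i (y i)) <=
     ((\prod_(i | i \notin s) p i (y i)) *
      iter_average p t s H (fun i => t i (y i)))%:E)%E.
  (* The induction runs from the right end because the last entry of the list is averaged
     outermost. *)
  elim/last_ind: s y => [|s i IHs] y.
    move=> _.
    have prod0 : 0 <= \prod_(i : I) p i (y i) by apply: prodr_ge0.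
    (* [H1] needs a point of [C] in the cell; an empty intersection has probability 0. *)
    have [->|/set0P[w [Cw Ew]]] := eqVneq
      (C `&` \bigcap_(i in [set i | i \notin [::]]) E i (y i)) set0.
      by rewrite measure0 lee_fin mulr_ge0.
    apply: (@le_trans _ _ (P (\bigcap_i E i (y i)))).
      apply: le_measure.
      - by apply/mem_set; exact: m_cell.
      - by apply/mem_set; exact: finType_bigcap_measurable.
      - by move=> v [_ Ev] k _; exact: Ev.
    rewrite E_indep lee_fin ler_peMr//.
    by apply: (H1 w y Cw) => k; exact: Ew.
  rewrite rcons_uniq => /andP[i_s s_uniq].
  rewrite /iter_average foldl_rcons -/(iter_average p t s H).
  set D := (X in P X).
  (* Choosing the cell of coordinate [i] inside [D] yields a set of the same shape for the shorter
     list. *)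
  have cellE j : D `&` E i j =
      C `&` \bigcap_(k in [set k | k \notin s]) E k (upd y i j k).
    apply/seteqP; split => [w [[Cw Dw] Eij]|w [Cw Dw]].
      split => // k /= k_s; rewrite /upd; case: eqP => [->//|/eqP ki].
      by apply: Dw; rewrite /= mem_rcons inE negb_or ki.
    split; last by have := Dw i i_s; rewrite /upd eqxx.
    split => // k; rewrite /= mem_rcons inE negb_or => /andP[ki k_s].
    by have := Dw k k_s; rewrite /upd (negbTE ki).
  have D_sub : D `<=` (~` \bigcup_j E i j) `|` \big[setU/set0]_(j : J) (D `&` E i j).
    move=> w Dw; case: (pselect ((\bigcup_j E i j) w)) => [[j _ Eij]|nE]; last by left.
    by right; rewrite -bigcup_seq; exists j => //=; exact: mem_index_enum.
  have mD : measurable D by exact: m_cell.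
  have m_union : measurable (\big[setU/set0]_(j : J) (D `&` E i j)).
    by apply: bigsetU_measurable => j _; exact: measurableI.
  have m_null : measurable (~` \bigcup_j E i j).
    by apply: measurableC; apply: fin_bigcup_measurable.
  apply: (@le_trans _ _ (\sum_(j : J) P (D `&` E i j))%E).
    apply: le_trans (content_bigsetU_le P _ _); last by move=> j; exact: measurableI.
    rewrite -[leRHS]add0e -[X in (X + _)%E](E_cover i).
    apply: le_trans (measureU2 _ _ _) => //.
    by apply: le_measure; rewrite ?inE//; exact: measurableU.
  rewrite /average mulr_sumr -sumEFin; apply: lee_sum => j _.
  rewrite cellE; apply: (le_trans (IHs (upd y i j) s_uniq)).
  rewrite lee_fin le_eqVlt; apply/orP; left; apply/eqP.
  rewrite (bigD1 i)//= {1}/upd eqxx -mulrA mulrCA.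
  have -> : (fun k => t k (upd y i j k)) = upd (fun k => t k (y k)) i (t i j).
    by apply/funext => k; rewrite /upd; case: eqP => // ->.
  congr (_ * _); apply: eq_big => k; first by rewrite mem_rcons inE negb_or andbC.
  by move=> /andP[_ ki]; rewrite /upd (negbTE ki).
have := cell (enum I) y0 (enum_uniq I).
rewrite big_pred0 ?mul1r; last by move=> i; rewrite mem_enum.
suff -> : [set i | i \notin enum I] = set0 by rewrite bigcap_set0 setIT.
by apply/seteqP; split => // i /=; rewrite mem_enum.
Qed.

(** * The supremum as a function of the coordinates *)

Definition lin_sup (R : realType) (N : nat) (F : set 'rV[R]_N) (x : 'I_N -> R) : R :=
  sup [set \sum_(i < N) a 0 i * x i | a in F].

Lemma l2norm_sqr (R : realType) (N : nat) (a : 'rV[R]_N) :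
  l2norm a ^+ 2 = \sum_(i < N) a 0 i ^+ 2.
Proof. by rewrite sqr_sqrtr// sumr_ge0// => i _; exact: sqr_ge0. Qed.

Lemma ler_norm_l2norm (R : realType) (N : nat) (a : 'rV[R]_N) (i : 'I_N) :
  `|a 0 i| <= l2norm a.
Proof.
rewrite -ler_sqr ?nnegrE ?sqrtr_ge0//.
rewrite l2norm_sqr real_normK ?num_real// (bigD1 i)//= lerDl.
by apply: sumr_ge0 => k _; exact: sqr_ge0.
Qed.

Lemma sum_sqr_le (R : realType) (N : nat) (a : 'rV[R]_N) (sigma : R) :
  l2norm a <= sigma -> \sum_(i < N) a 0 i ^+ 2 <= sigma ^+ 2.
Proof.
move=> a_le; rewrite -l2norm_sqr.
by rewrite lerXn2r// nnegrE ?sqrtr_ge0//; apply: le_trans a_le; exact: sqrtr_ge0.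
Qed.

(** Young's inequality term by term, from the square of [lam * a 0 i - x i / 2]. *)
Lemma lin_quadratic_le (R : realType) (N : nat) (a : 'rV[R]_N) (x : 'I_N -> R)
    (sigma lam : R) : l2norm a <= sigma ->
  lam * (\sum_(i < N) a 0 i * x i) <=
  lam ^+ 2 * sigma ^+ 2 + \sum_(i < N) x i ^+ 2 / 4.
Proof.
move=> /sum_sqr_le a_le.
apply: (@le_trans _ _
  (lam ^+ 2 * (\sum_(i < N) a 0 i ^+ 2) + \sum_(i < N) x i ^+ 2 / 4)); last first.
  by rewrite lerD2r ler_wpM2l ?sqr_ge0.
rewrite !mulr_sumr -big_split; apply: ler_sum => i _ /=.
have : 0 <= (lam * a 0 i - x i / 2) ^+ 2 by exact: sqr_ge0.
lra.
Qed.

Lemma lin_sup_ge (R : realType) (N : nat) (F : set 'rV[R]_N) (sigma : R)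
    (a : 'rV[R]_N) (x : 'I_N -> R) :
  (forall b, F b -> l2norm b <= sigma) -> F a ->
  \sum_(i < N) a 0 i * x i <= lin_sup F x.
Proof.
move=> F_le Fa; apply: ub_le_sup; last by exists a.
(* Young's inequality with [lam = 1] shows that the set is bounded above. *)
exists (1 ^+ 2 * sigma ^+ 2 + \sum_(i < N) x i ^+ 2 / 4) => _ [b Fb <-].
by rewrite -[leLHS]mul1r; apply: lin_quadratic_le; exact: F_le.
Qed.

Lemma lin_sup_le (R : realType) (N : nat) (F : set 'rV[R]_N) (x : 'I_N -> R) (c : R) :
  F !=set0 -> (forall a, F a -> \sum_(i < N) a 0 i * x i <= c) -> lin_sup F x <= c.
Proof.
move=> [a Fa] le_c; apply: ge_sup; first by exists (\sum_(i < N) a 0 i * x i); exists a.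
by move=> _ [b Fb <-]; exact: le_c.
Qed.

Lemma lin_sup_convex (R : realType) (N : nat) (F : set 'rV[R]_N) (sigma : R) :
  F !=set0 -> (forall b, F b -> l2norm b <= sigma) -> convex_fun (lin_sup F).
Proof.
move=> F0 F_le th x y /andP[th0 th1]; apply: lin_sup_le => // a Fa.
have th1' : 0 <= 1 - th by rewrite subr_ge0.
have := ler_wpM2l th0 (lin_sup_ge x F_le Fa).
have := ler_wpM2l th1' (lin_sup_ge y F_le Fa).
suff -> : \sum_(i < N) a 0 i * (th * x i + (1 - th) * y i) =
  th * (\sum_(i < N) a 0 i * x i) + (1 - th) * (\sum_(i < N) a 0 i * y i) by lra.
by rewrite !mulr_sumr -big_split; apply: eq_bigr => i _ /=; ring.
Qed.

Lemma lin_sup_split (R : realType) (N : nat) (F : set 'rV[R]_N) (sigma : R)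
    (a : 'rV[R]_N) (x y : 'I_N -> R) :
  (forall b, F b -> l2norm b <= sigma) -> F a ->
  \sum_(i < N) a 0 i * x i <= lin_sup F y + \sum_(i < N) a 0 i * (x i - y i).
Proof.
move=> F_le Fa; apply: le_trans (lerD (lin_sup_ge y F_le Fa) (lexx _)).
by rewrite -big_split/= le_eqVlt; apply/orP; left; apply/eqP; apply: eq_bigr => i _; ring.
Qed.

(** The hypothesis of [maurey] for f = lam * lin_sup F and g = f - lam^2 sigma^2. *)
Lemma lin_sup_quadratic_le (R : realType) (N : nat) (F : set 'rV[R]_N)
    (sigma lam : R) (x y : 'I_N -> R) : F !=set0 -> 0 < lam ->
  (forall b, F b -> l2norm b <= sigma) ->
  lam * lin_sup F x - lam ^+ 2 * sigma ^+ 2 <=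
  lam * lin_sup F y + \sum_(i < N) (x i - y i) ^+ 2 / 4.
Proof.
move=> F0 lam0 F_le.
rewrite lerBlDr -ler_pdivlMl//; apply: lin_sup_le => // a Fa.
rewrite ler_pdivlMl//.
have := ler_wpM2l (ltW lam0) (lin_sup_split x y F_le Fa).
have := lin_quadratic_le (fun i => x i - y i) lam (F_le a Fa).
lra.
Qed.

(** The crude factor N is harmless: the bound serves only with [e] tending to 0 or with sigma =
    0. *)
Lemma lin_sup_lipschitz (R : realType) (N : nat) (F : set 'rV[R]_N)
    (sigma e : R) (x y : 'I_N -> R) : F !=set0 -> 0 <= sigma ->
  (forall b, F b -> l2norm b <= sigma) -> (forall i, `|x i - y i| <= e) ->
  lin_sup F x <= lin_sup F y + N%:R * (sigma * e).
Proof.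
move=> F0 sigma0 F_le xy; apply: lin_sup_le => // a Fa.
apply: (le_trans (lin_sup_split x y F_le Fa)); rewrite lerD2l.
apply: (@le_trans _ _ (\sum_(i < N) sigma * e)); last first.
  by rewrite sumr_const card_ord mulr_natl.
apply: ler_sum => i _; apply: (le_trans (ler_norm _)); rewrite normrM.
apply: ler_pM => //; apply: le_trans (F_le a Fa); exact: ler_norm_l2norm.
Qed.

(** * Rounding to the grid *)

Lemma floor_cell_measurable (R : realType) (m : nat) (k : int) :
  measurable [set v : R | Num.floor (m.+1%:R * v) = k].
Proof.
have -> : [set v : R | Num.floor (m.+1%:R * v) = k] =
    `[k%:~R / m.+1%:R, (k + 1)%:~R / m.+1%:R[%classic.
  apply/seteqP; split => v /=; rewrite in_itv/= ler_pdivrMr// ltr_pdivlMr// [v * _]mulrC.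
    by move=> <-; exact: floor_itv.
  exact: floor_def.
exact: measurable_itv.
Qed.

Lemma floor_approx (R : realType) (m : nat) (x : R) :
  `|x - (Num.floor (m.+1%:R * x))%:~R / m.+1%:R| <= m.+1%:R^-1.
Proof.
have m0 : 0 < m.+1%:R :> R by [].
rewrite -(ler_pM2l m0) -[X in X * `|_|]gtr0_norm// -normrM mulrBr mulrCA divff// mulr1.
have := floor_itv (m.+1%:R * x); rewrite intrD => /andP[h1 h2].
by rewrite ger0_norm; lra.
Qed.

(** [F] may be uncountable, so the supremum is obtained as a pointwise limit of its values at
    rounded coordinates, each of countable range. *)
Lemma lin_sup_measurable (R : realType) (N : nat) (F : set 'rV[R]_N) (sigma : R)
    (d : measure_display) (T : measurableType d) (X : 'I_N -> {mfun T >-> R}) :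
  F !=set0 -> 0 <= sigma -> (forall b, F b -> l2norm b <= sigma) ->
  measurable_fun [set: T] (fun w => lin_sup F (fun i => X i w)).
Proof.
move=> F0 sigma0 F_le.
pose grid n w : {ffun 'I_N -> int} := [ffun i => Num.floor (n.+1%:R * X i w)].
pose h n w := lin_sup F (fun i => (grid n w i)%:~R / n.+1%:R).
apply: (@measurable_realfun.measurable_fun_cvg _ _ _ _ h).
  move=> n _ B mB; rewrite setTI.
  have -> : h n @^-1` B = \bigcup_(k : {ffun 'I_N -> int})
      ([set w | B (lin_sup F (fun i => (k i)%:~R / n.+1%:R)) /\ grid n w = k]).
    by apply/seteqP; split => [w Bw|w [k _ [/[swap] <-]]//]; exists (grid n w).
  apply: countable_bigcupT_measurable => // k.
  have [Bk|nBk] := pselect (B (lin_sup F (fun i => (k i)%:~R / n.+1%:R))); last first.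
    by rewrite (_ : mkset _ = set0)//; apply/seteqP; split => // w [].
  rewrite (_ : mkset _ =
    \bigcap_(i : 'I_N) X i @^-1` [set v | Num.floor (n.+1%:R * v) = k i]).
    apply: finType_bigcap_measurable => i; apply: measurable_funPTI.
    exact: floor_cell_measurable.
  apply/seteqP; split => [w [_ <-] i _ /=|w kw]; first by rewrite ffunE.
  by split => //; apply/ffunP => i; rewrite ffunE; exact: kw.
move=> w _.
have close n i : `|X i w - (grid n w i)%:~R / n.+1%:R| <= n.+1%:R^-1.
  by rewrite ffunE; exact: floor_approx.
have lim0 : (fun n : nat => N%:R * (sigma * n.+1%:R^-1)) @ \oo --> (0 : R).
  rewrite -[X in _ --> X](mulr0 (N%:R : R)); apply: cvgMr.
  by rewrite -[X in _ --> X](mulr0 sigma); apply: cvgMr; exact: cvg_harmonic.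
have Z_cst : (fun n : nat => lin_sup F (fun i => X i w)) @ \oo -->
    lin_sup F (fun i => X i w).
  exact: cvg_cst.
have lo := cvgB Z_cst lim0; have hi := cvgD Z_cst lim0.
rewrite subr0 in lo; rewrite addr0 in hi.
apply: (squeeze_cvgr _ (lo _) (hi _)); apply: nearW => n /=; apply/andP; split.
  by rewrite lerBlDr; apply: lin_sup_lipschitz.
by apply: lin_sup_lipschitz => // i; rewrite distrC.
Qed.

(** Scaled by m + 1, the interval [r, r + 1] has length m + 1 and so meets at most m + 2 unit cells,
    whence the index type ['I_m.+2]. *)
Definition floor_cell (R : realType) (T : Type) (m : nat) (r : R) (X : T -> R)
    (j : 'I_m.+2) : set T :=
  X @^-1` [set v | Num.floor (m.+1%:R * v) = Num.floor (m.+1%:R * r) + j%:Z].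
Arguments floor_cell {R T m}.

Lemma floor_cell_cover (R : realType) (d : measure_display) (T : measurableType d)
    (P : probability T R) (m : nat) (r : R) (X : {RV P >-> R}) :
  {ae P, forall w, r <= X w <= r + 1} ->
  P (~` \bigcup_(j : 'I_m.+2) floor_cell r X j) = 0%E.
Proof.
move=> X_bnd; apply: measure_negligible.
  apply: measurableC; apply: fin_bigcup_measurable => // j _.
  by apply: measurable_funPTI; exact: floor_cell_measurable.
apply: negligibleS X_bnd => w /=; apply: contra_not => /andP[rX Xr].
have m0 : 0 < m.+1%:R :> R by [].
set k := Num.floor (m.+1%:R * r).
have lo : k <= Num.floor (m.+1%:R * X w).
  by apply: le_floor; rewrite ler_pM2l.
have hi : Num.floor (m.+1%:R * X w) < k + m.+2%:Z.
  rewrite floor_lt_int; apply: (@le_lt_trans _ _ (m.+1%:R * (r + 1))).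
    by rewrite ler_pM2l.
  have := floor_itv (m.+1%:R * r); rewrite -/k => /andP[_].
  rewrite mulrDr mulr1 !intrD -!pmulrn -[m.+2]addn1 natrD; lra.
have [n nE] : exists n : nat, Num.floor (m.+1%:R * X w) - k = n%:Z.
  have : 0 <= Num.floor (m.+1%:R * X w) - k by rewrite subr_ge0.
  by case: (Num.floor (m.+1%:R * X w) - k) => // n _; exists n.
have n_lt : (n < m.+2)%N by rewrite -ltz_nat -nE ltrBlDl.
by exists (Ordinal n_lt) => //; rewrite /floor_cell/= -nE addrC subrK.
Qed.

Lemma floor_cell_sum (R : realType) (d : measure_display) (T : measurableType d)
    (P : probability T R) (m : nat) (r : R) (X : {RV P >-> R}) :
  {ae P, forall w, r <= X w <= r + 1} ->
  \sum_(j < m.+2) fine (P (floor_cell r X j)) = 1.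
Proof.
move=> X_bnd.
have mE j : measurable (floor_cell (m := m) r X j).
  by apply: measurable_funPTI; exact: floor_cell_measurable.
apply: EFin_inj; rewrite -sumEFin.
under eq_bigr do rewrite fineK ?fin_num_measure//.
rewrite -(measure_bigsetU_ord P xpredT)//; last first.
  move=> i j _ _ [w []]; rewrite /floor_cell/= => -> /addrI [ij].
  exact/val_inj.
have mU : measurable (\bigcup_(j : 'I_m.+2) floor_cell r X j).
  by apply: fin_bigcup_measurable.
rewrite (_ : \big[_/_]_(i < m.+2 | _) _ = \bigcup_(j : 'I_m.+2) floor_cell r X j).
  have := floor_cell_cover m X_bnd; rewrite probability_setC// => /eqP.
  by rewrite sube_eq ?fin_num_measure// add0e => /eqP.
rewrite -bigcup_seq; apply/seteqP; split => [w [j _ jw]|w [j _ jw]]; exists j => //=.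
exact: mem_index_enum.
Qed.

(** * Products of opposite tails and the median bound *)

(** Each tail is dominated by an exponential of the supremum at rounded coordinates, at a cost of
    [delta] in the level; the two costs give the term 2 lam delta. *)
Lemma tail_product_grid (R : realType) (N : nat) (F : set 'rV[R]_N) (sigma : R)
    (d : measure_display) (T : measurableType d) (P : probability T R)
    (X : 'I_N -> {RV P >-> R}) (c u lam : R) (m : nat) :
  F !=set0 -> 0 <= sigma -> (forall b, F b -> l2norm b <= sigma) ->
  mutually_independent X ->
  (forall i, exists r : R, {ae P, forall w, r <= X i w <= r + 1}) ->
  0 < lam ->
  (P [set w | (c + u <= lin_sup F (fun i => X i w))%R] *
   P [set w | (lin_sup F (fun i => X i w) <= c)%R] <=
   (expR (lam ^+ 2 * sigma ^+ 2 - lam * u +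
          2 * lam * (N%:R * (sigma * m.+1%:R^-1))))%:E)%E.
Proof.
move=> F0 sigma0 F_le X_indep /choice[r X_bnd] lam0.
have mZ := lin_sup_measurable X F0 sigma0 F_le.
set Z := fun w => lin_sup F (fun i => X i w).
set delta := N%:R * (sigma * m.+1%:R^-1).
have m0 : 0 < m.+1%:R :> R by [].
pose E i j := floor_cell (m := m) (r i) (X i) j.
pose p i j := fine (P (E i j)).
pose t i (j : 'I_m.+2) : R :=
  (Num.floor (m.+1%:R * r i) + j%:Z)%:~R / m.+1%:R.
have mE i j : measurable (E i j).
  by apply: measurable_funPTI; exact: floor_cell_measurable.
have p0 i j : 0 <= p i j by rewrite fine_ge0.
have p1 i : \sum_j p i j = 1 by exact: floor_cell_sum.
(* Indices differ by at most m + 1, so the m + 2 grid points still lie in a set of diameter 1: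
   rounding does not spoil the diameter hypothesis. *)
have t_diam i j k : `|t i j - t i k| <= 1.
  rewrite /t -mulrBl -rmorphB/= opprD addrACA subrr add0r normrM normfV.
  rewrite [X in _ / X]gtr0_norm// ler_pdivrMr// mul1r rmorphB/= -!pmulrn.
  have := leq_ord j; have := leq_ord k.
  rewrite -!(ler_nat R) => hk hj; rewrite ler_norml.
  have := ler0n R j; have := ler0n R k; lra.
have E_indep (y : 'I_N -> 'I_m.+2) :
    P (\bigcap_i E i (y i)) = (\prod_i p i (y i))%:E.
  rewrite -prodEFin.
  under [RHS]eq_bigr do rewrite fineK ?fin_num_measure//.
  have := @X_indep [set: 'I_N]%SET (fun i => [set v |
    Num.floor (m.+1%:R * v) = Num.floor (m.+1%:R * r i) + (y i)%:Z]).
  rewrite (_ : [set` [set: 'I_N]%SET] = [set: 'I_N]).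
    move=> ->; first by apply: eq_bigl => i; rewrite inE.
    by move=> i _; exact: floor_cell_measurable.
  by apply/seteqP; split => // i _ /=; rewrite inE.
have near_cell w (y : 'I_N -> 'I_m.+2) : (forall i, E i (y i) w) ->
    Z w <= lin_sup F (fun i => t i (y i)) + delta /\
    lin_sup F (fun i => t i (y i)) <= Z w + delta.
  move=> Ew; have close i : `|X i w - t i (y i)| <= m.+1%:R^-1.
    by rewrite /t -(Ew i); exact: floor_approx.
  by split; apply: lin_sup_lipschitz => // i; rewrite distrC.
pose x0 i := t i ord0.
have E_cover i : P (~` \bigcup_j E i j) = 0%E by exact: floor_cell_cover.
have upper : (P [set w | (c + u <= Z w)%R] <= (iter_average p t (enum 'I_N)
    (fun x => expR (lam * (lin_sup F x - (c + u - delta)))) x0)%:E)%E.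
  apply: (@probability_le_iter_average _ _ _ _ _ P p t E _ _ (fun=> ord0)) => //.
  - by rewrite -[X in measurable X]setTI; apply: measurable_fun_le.
  - move=> w y /= cZ /near_cell[Zt _]; rewrite -expR0 ler_expR mulr_ge0 ?(ltW lam0)//.
    by rewrite subr_ge0 lerBlDr (le_trans cZ).
have lower : (P [set w | (Z w <= c)%R] <= (iter_average p t (enum 'I_N)
    (fun x => expR (lam * (c + delta - lin_sup F x))) x0)%:E)%E.
  apply: (@probability_le_iter_average _ _ _ _ _ P p t E _ _ (fun=> ord0)) => //.
  - by rewrite -[X in measurable X]setTI; apply: measurable_fun_le.
  - move=> w y /= Zc /near_cell[_ tZ]; rewrite -expR0 ler_expR mulr_ge0 ?(ltW lam0)//.
    by rewrite subr_ge0 (le_trans tZ)// lerD2r.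
have f_convex : convex_fun (fun x => lam * lin_sup F x).
  move=> th x y th01; have := ler_wpM2l (ltW lam0) (lin_sup_convex F0 F_le x y th01).
  by rewrite mulrDr !(mulrCA lam).
have tau := @maurey R _ _ p t (enum 'I_N) (fun x => lam * lin_sup F x)
  (fun x => lam * lin_sup F x - lam ^+ 2 * sigma ^+ 2) x0 p0 p1 t_diam
  (enum_uniq _) f_convex.
apply: le_trans (lee_pmul _ _ upper lower) _ => //.
rewrite -EFinM lee_fin.
(* Constants are factored out so that the two averages take the form required by [tau]. *)
rewrite (_ : (fun x => _) =
  (fun x => expR (lam ^+ 2 * sigma ^+ 2 - lam * (c + u - delta)) *
            expR (lam * lin_sup F x - lam ^+ 2 * sigma ^+ 2))); last first.
  by apply/funext => x; rewrite -expRD; congr expR; ring.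
rewrite iter_averageZ.
rewrite (_ : (fun x => expR (lam * (c + delta - lin_sup F x))) =
  (fun x => expR (lam * (c + delta)) * expR (- (lam * lin_sup F x)))); last first.
  by apply/funext => x; rewrite -expRD; congr expR; ring.
rewrite iter_averageZ mulrACA -expRD.
rewrite (_ : _ - _ + _ = lam ^+ 2 * sigma ^+ 2 - lam * u + 2 * lam * delta); last ring.
rewrite ler_piMr ?expR_ge0//; apply: tau => x y.
rewrite big_enum; exact: lin_sup_quadratic_le.
Qed.

(** The left side does not depend on the mesh, so for fixed [lam] the rounding error vanishes in the
    limit. *)
Lemma tail_product (R : realType) (N : nat) (F : set 'rV[R]_N) (sigma : R)
    (d : measure_display) (T : measurableType d) (P : probability T R)
    (X : 'I_N -> {RV P >-> R}) (c u : R) :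
  F !=set0 -> 0 < sigma -> (forall b, F b -> l2norm b <= sigma) ->
  mutually_independent X ->
  (forall i, exists r : R, {ae P, forall w, r <= X i w <= r + 1}) ->
  0 < u ->
  (P [set w | (c + u <= lin_sup F (fun i => X i w))%R] *
   P [set w | (lin_sup F (fun i => X i w) <= c)%R] <=
   (expR (- (u ^+ 2 / (4 * sigma ^+ 2))))%:E)%E.
Proof.
move=> F0 sigma0 F_le X_indep X_bnd u0.
(* This value minimises lam^2 sigma^2 - lam u. *)
pose lam := u / (2 * sigma ^+ 2).
have lam0 : 0 < lam by rewrite divr_gt0// mulr_gt0// exprn_gt0.
have -> : - (u ^+ 2 / (4 * sigma ^+ 2)) = lam ^+ 2 * sigma ^+ 2 - lam * u.
  by rewrite /lam; field; rewrite gt_eqF.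
have grid m := @tail_product_grid R N F sigma d T P X c u lam m
  F0 (ltW sigma0) F_le X_indep X_bnd lam0.
have mZ := lin_sup_measurable X F0 (ltW sigma0) F_le.
set A := [set w | _] in grid *; set B := [set w | (_ <= c)%R] in grid *.
have mA : measurable A by rewrite -[A]setTI; exact: measurable_fun_le.
have mB : measurable B by rewrite -[B]setTI; exact: measurable_fun_le.
rewrite -(fineK (fin_num_measure P A mA)) -(fineK (fin_num_measure P B mB)) in grid *.
rewrite -EFinM lee_fin in grid *.
set b := _ - _ in grid *.
have lim : (fun m : nat => expR (b + 2 * lam * (N%:R * (sigma * m.+1%:R^-1)))) @ \oo
    --> expR b.
  apply: continuous_cvg; first exact: continuous_expR.
  rewrite -[X in _ --> X]addr0; apply: cvgD; first exact: cvg_cst.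
  rewrite -(mulr0 (2 * lam)); apply: cvgMr.
  rewrite -[X in _ --> X](mulr0 (N%:R : R)); apply: cvgMr.
  by rewrite -[X in _ --> X](mulr0 sigma); apply: cvgMr; exact: cvg_harmonic.
by apply: (cvgr_to_ge lim); apply: nearW => m; exact: grid.
Qed.

(* When sigma = 0 the quotient below is taken in the extended reals, where
   0^-1 = +oo and expeR -oo = 0, so the bound is then 0 and not 4. *)
Theorem theorem8p1p1 (R : realType) (N : nat) (F : set 'rV[R]_N)
    (F_neq0 : F !=set0)
    (sigma_fin : has_ubound [set l2norm a | a in F])
    (d : measure_display) (T : measurableType d) (P : probability T R)
    (X : 'I_N -> {RV P >-> R})
    (X_indep : mutually_independent X)
    (X_bnd : forall i, exists r : R, {ae P, forall w, r <= X i w <= r + 1}) :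
  let sigma : R := sup [set l2norm a | a in F] in
  let Z : T -> R := fun w => sup [set \sum_(i < N) a 0 i * X i w | a in F] in
  forall M : R, is_median P Z M ->
  forall u : R, 0 < u ->
    (P [set w | (u <= `|Z w - M|)%R] <=
     4%:E * expeR (- ((u ^+ 2)%:E / (4 * sigma ^+ 2)%:E)))%E.
Proof.
move=> sigma Z M [med_le med_ge] u u0.
have F_le b : F b -> l2norm b <= sigma by move=> Fb; apply: ub_le_sup => //; exists b.
have sigma0 : 0 <= sigma.
  by have [b Fb] := F_neq0; apply: le_trans (F_le b Fb); exact: sqrtr_ge0.
(* If sigma = 0 then Z vanishes identically, its median is 0, and the event is empty because u >
   0. *)
have [sigma_eq0|sigma_neq0] := eqVneq sigma 0.
  have Z0 w : Z w = 0.
    have lip x y : lin_sup F x <= lin_sup F y :> R.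
      have := @lin_sup_lipschitz R N F sigma (\sum_(i < N) `|x i - y i|) x y
        F_neq0 sigma0 F_le.
      rewrite sigma_eq0 mul0r mulr0 addr0; apply => i.
      by rewrite (bigD1 i)//= lerDl sumr_ge0.
    have -> : Z w = lin_sup F (fun=> 0).
      by apply: le_anti; rewrite !lip.
    apply: le_anti; apply/andP; split.
      by apply: lin_sup_le => // a _; rewrite big1// => i _; rewrite mulr0.
    have [b Fb] := F_neq0; apply: le_trans (lin_sup_ge _ F_le Fb).
    by rewrite big1// => i _; rewrite mulr0.
  have half0 : ~ ((2^-1)%:E <= P set0)%E.
    by rewrite measure0 lee_fin; apply/negP; rewrite -ltNge invr_gt0.
  have M0 : M = 0.
    apply: le_anti; apply/andP; split; rewrite leNgt; apply/negP => M_ne.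
      apply: half0; rewrite (_ : set0 = [set w | M <= Z w])//.
      by apply/seteqP; split => // w /=; rewrite Z0 leNgt M_ne.
    apply: half0; rewrite (_ : set0 = [set w | Z w <= M])//.
    by apply/seteqP; split => // w /=; rewrite Z0 leNgt M_ne.
  rewrite (_ : [set w | _] = set0); last first.
    by apply/seteqP; split => // w /=; rewrite Z0 M0 subrr normr0 leNgt u0.
  by rewrite measure0 mule_ge0 ?expeR_ge0.
have sigma_gt0 : 0 < sigma by rewrite lt_neqAle eq_sym sigma_neq0.
have mZ : measurable_fun [set: T] Z by exact: (lin_sup_measurable X F_neq0 sigma0 F_le).
have m_ge c : measurable [set w | c <= Z w].
  by rewrite -[X in measurable X]setTI; exact: measurable_fun_le.
have m_le c : measurable [set w | Z w <= c].
  by rewrite -[X in measurable X]setTI; exact: measurable_fun_le.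
have tails c := tail_product c F_neq0 sigma_gt0 F_le X_indep X_bnd u0.
rewrite inver mulf_eq0 sqrf_eq0 (negbTE sigma_neq0) pnatr_eq0/=.
rewrite -EFinM.
set e := expR _ in tails *.
(* Dividing by a probability of at least 1/2 costs a factor 2; the two tails together give the
   constant 4. *)
have half (a b : \bar R) : a \is a fin_num -> b \is a fin_num -> (0 <= a)%E ->
    ((2^-1)%:E <= b)%E -> (a * b <= e%:E)%E -> (a <= (2 * e)%:E)%E.
  move=> /fineK <- /fineK <-; rewrite -EFinM !lee_fin => a0 hb ab.
  by have := ler_wpM2l a0 hb; lra.
rewrite (_ : [set w | _] =
  [set w | M + u <= Z w] `|` [set w | Z w <= M - u]); last first.
  apply/seteqP; split => w /=; rewrite ler_normr.
    by move=> /orP[h|h]; [left|right]; lra.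
  by move=> [h|h]; apply/orP; [left|right]; lra.
apply: (le_trans (measureU2 _ (m_ge _) (m_le _))).
rewrite (_ : 4 * e = 2 * e + 2 * e); last ring.
rewrite EFinD.
have fin_ge c := fin_num_measure P _ (m_ge c).
have fin_le c := fin_num_measure P _ (m_le c).
apply: leeD.
  exact: half (fin_ge _) (fin_le _) (measure_ge0 _ _) med_le (tails M).
(* For the lower tail the level is c = M - u, so c + u = M and the upper event is the one of
   probability at least 1/2. *)
apply: half (fin_le _) (fin_ge _) (measure_ge0 _ _) med_ge _.
by rewrite muleC; have := tails (M - u); rewrite subrK.
Qed.
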